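(* Let $\mathbb{X}$ be a two-nilpotent semi-abelian category. Then $\mathbb{X}$ satisfies condition (W).
   Context: A semi-abelian category is a pointed, Barr exact, Bourn protomodular category with binary coproducts. For morphisms $u\colon U\to D$, $v\colon V\to D$ (and $t\colon T\to D$), $\langle u;v\rangle\colon U+V\to D$ (and $\langle u;v;t\rangle\colon U+V+T\to D$) denotes the induced morphism out of the coproduct. $\mathrm{Im}$ denotes the regular image. For objects $K,L,M$, the ternary co-smash product $K\diamond L\diamond M$ is the kernel of the canonical morphism $K+L+M\to(K+L)\times(K+M)\times(L+M)$ whose components send the missing summand to $0$ and are the coproduct inclusions on the other two. A semi-abelian category is two-nilpotent if all ternary co-smash products $K\diamond L\diamond M$ in it are trivial (zero). Morphisms $x\colon X\to D$ and $y\colon Y\to D$ Huq-commute if there is $\varphi\colon X\times Y\to D$ with $\varphi\circ\langle1_X,0\rangle=x$ and $\varphi\circ\langle0,1_Y\rangle=y$. A weighted cospan $(x,y,w)$ consists of morphisms $x\colon X\to D$, $y\colon Y\to D$, $w\colon W\to D$ with common codomain; $w$ is called the weight. The morphisms $x$ and $y$ commute over $w$ if there is a morphism $\varphi\colon (W+X)\times_W(W+Y)\to D$ such that $\varphi\circ e_1=\langle w;x\rangle$ and $\varphi\circ e_2=\langle w;y\rangle$. Here the pullback is that of $f=\langle 1_W;0\rangle\colon W+X\to W$ and $g=\langle 1_W;0\rangle\colon W+Y\to W$; writing $r\colon W\to W+X$, $s\colon W\to W+Y$ for the coproduct inclusions, $e_1=\langle 1_{W+X},s\circ f\rangle$ and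 $e_2=\langle r\circ g,1_{W+Y}\rangle$. Higgins commutators: for subobjects $k\colon K\to D$, $l\colon L\to D$, $m\colon M\to D$, $[K,L]\leq D$ is the image of the composite $K\diamond L\to K+L\xrightarrow{\langle k;l\rangle}D$, where $K\diamond L$ is the kernel of the canonical morphism $K+L\to K\times L$; and $[K,L,M]\leq D$ is the image of the composite $K\diamond L\diamond M\to K+L+M\xrightarrow{\langle k;l;m\rangle}D$. A semi-abelian category satisfies condition (W) when it satisfies the following equivalent conditions: (i) for any weighted cospan $(x,y,w)$, the morphisms $x$ and $y$ commute over $w$ as soon as they Huq-commute; (ii) for any cospan $(x,y)$ (pair of morphisms with common codomain), the property of commuting over $w$ is independent of the chosen weight $w$ making $(x,y,w)$ a weighted cospan; (iii) for any weighted cospan $(x,y,w)$, if $[\mathrm{Im}(x),\mathrm{Im}(y)]=0$ then $[\mathrm{Im}(x),\mathrm{Im}(y),\mathrm{Im}(w)]=0$. *)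

(* Defs.v *)
Set Implicit Arguments.
Unset Strict Implicit.
Unset Printing Implicit Defensive.

Declare Scope cat_scope.
Delimit Scope cat_scope with cat.
Local Open Scope cat_scope.

Reserved Notation "X ~> Y" (at level 90, right associativity).
Reserved Notation "g ∘ f" (at level 40, left associativity).

Record category := Category {
  Ob :> Type;
  Hom : Ob -> Ob -> Type where "X ~> Y" := (Hom X Y);
  idm : forall X : Ob, X ~> X;
  comp : forall X Y Z : Ob, (Y ~> Z) -> (X ~> Y) -> (X ~> Z)
    where "g ∘ f" := (comp g f);
  comp_idl : forall (X Y : Ob) (f : X ~> Y), idm Y ∘ f = f;
  comp_idr : forall (X Y : Ob) (f : X ~> Y), f ∘ idm X = f;
  comp_assoc : forall (X Y Z T : Ob) (h : Z ~> T) (g : Y ~> Z) (f : X ~> Y),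
    h ∘ (g ∘ f) = (h ∘ g) ∘ f
}.

Arguments Hom {c} X Y.
Arguments idm {c} X.
Arguments comp {c X Y Z} g f.
Notation "X ~> Y" := (Hom X Y) : cat_scope.
Notation "g ∘ f" := (comp g f) : cat_scope.

Section Notions.
Variable C : category.

Definition is_mono (X Y : C) (m : X ~> Y) : Prop :=
  forall (T : C) (a b : T ~> X), m ∘ a = m ∘ b -> a = b.

Definition is_iso (X Y : C) (f : X ~> Y) : Prop :=
  exists g : Y ~> X, g ∘ f = idm X /\ f ∘ g = idm Y.

Definition is_pullback (X Y Z P : C) (f : X ~> Z) (g : Y ~> Z)
    (p1 : P ~> X) (p2 : P ~> Y) : Prop :=
  f ∘ p1 = g ∘ p2 /\
  forall (T : C) (a : T ~> X) (b : T ~> Y), f ∘ a = g ∘ b ->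
    exists! c : T ~> P, p1 ∘ c = a /\ p2 ∘ c = b.

Definition is_coequalizer (X Y Q : C) (a b : X ~> Y) (q : Y ~> Q) : Prop :=
  q ∘ a = q ∘ b /\
  forall (T : C) (h : Y ~> T), h ∘ a = h ∘ b -> exists! k : Q ~> T, k ∘ q = h.

Definition is_regular_epi (Y Q : C) (q : Y ~> Q) : Prop :=
  exists (X : C) (a b : X ~> Y), is_coequalizer a b q.

Record is_equivalence_relation (R X : C) (r1 r2 : R ~> X) : Prop := {
  eqrel_jointly_monic : forall (T : C) (a b : T ~> R),
    r1 ∘ a = r1 ∘ b -> r2 ∘ a = r2 ∘ b -> a = b;
  eqrel_reflexive : exists d : X ~> R, r1 ∘ d = idm X /\ r2 ∘ d = idm X;
  eqrel_symmetric : exists s : R ~> R, r1 ∘ s = r2 /\ r2 ∘ s = r1;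
  eqrel_transitive : forall (P : C) (p1 p2 : P ~> R),
    is_pullback r2 r1 p1 p2 ->
    exists t : P ~> R, r1 ∘ t = r1 ∘ p1 /\ r2 ∘ t = r2 ∘ p2
}.

(* Effective: (r1, r2) is the kernel cpair of some morphism. *)
Definition is_effective (R X : C) (r1 r2 : R ~> X) : Prop :=
  exists (Q : C) (q : X ~> Q), is_pullback q q r1 r2.

Definition regular_epis_stable : Prop :=
  forall (X Y Z P : C) (f : X ~> Z) (g : Y ~> Z) (p1 : P ~> X) (p2 : P ~> Y),
    is_pullback f g p1 p2 -> is_regular_epi f -> is_regular_epi p2.

Definition equivalence_relations_effective : Prop :=
  forall (R X : C) (r1 r2 : R ~> X),
    is_equivalence_relation r1 r2 -> is_effective r1 r2.

(* For every v : Y' ~> Y, the change-of-base functor v^* : Pt(Y) -> Pt(Y')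
   between categories of points reflects isomorphisms: h is a morphism from the
   point (p, s) to the point (q, t) over Y, and h' is its image under v^*. It
   commutes automatically with the induced sections. *)
Definition protomodular : Prop :=
  forall (Y Y' : C) (v : Y' ~> Y)
    (A : C) (p : A ~> Y) (s : Y ~> A) (B : C) (q : B ~> Y) (t : Y ~> B)
    (h : A ~> B)
    (A' : C) (a : A' ~> A) (p' : A' ~> Y') (B' : C) (b : B' ~> B) (q' : B' ~> Y')
    (h' : A' ~> B'),
    p ∘ s = idm Y -> q ∘ t = idm Y -> q ∘ h = p -> h ∘ s = t ->
    is_pullback p v a p' -> is_pullback q v b q' ->
    b ∘ h' = h ∘ a -> q' ∘ h' = p' ->
    is_iso h' -> is_iso h.

Record zero_object := ZeroObject {
  zero_ob : C;
  to_zero : forall X : C, X ~> zero_ob;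
  from_zero : forall X : C, zero_ob ~> X;
  to_zero_unique : forall (X : C) (a b : X ~> zero_ob), a = b;
  from_zero_unique : forall (X : C) (a b : zero_ob ~> X), a = b
}.

Record pullback (X Y Z : C) (f : X ~> Z) (g : Y ~> Z) := Pullback {
  pb_ob : C;
  pb_fst : pb_ob ~> X;
  pb_snd : pb_ob ~> Y;
  pb_square : f ∘ pb_fst = g ∘ pb_snd;
  pb_pair : forall (T : C) (a : T ~> X) (b : T ~> Y),
    f ∘ a = g ∘ b -> T ~> pb_ob;
  pb_fst_pair : forall (T : C) (a : T ~> X) (b : T ~> Y) (e : f ∘ a = g ∘ b),
    pb_fst ∘ pb_pair e = a;
  pb_snd_pair : forall (T : C) (a : T ~> X) (b : T ~> Y) (e : f ∘ a = g ∘ b),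
    pb_snd ∘ pb_pair e = b;
  pb_jointly_monic : forall (T : C) (c d : T ~> pb_ob),
    pb_fst ∘ c = pb_fst ∘ d -> pb_snd ∘ c = pb_snd ∘ d -> c = d
}.

Record coproduct (X Y : C) := Coproduct {
  cop_ob : C;
  cop_inl : X ~> cop_ob;
  cop_inr : Y ~> cop_ob;
  cop_copair : forall D : C, (X ~> D) -> (Y ~> D) -> (cop_ob ~> D);
  cop_copair_inl : forall (D : C) (u : X ~> D) (v : Y ~> D),
    cop_copair u v ∘ cop_inl = u;
  cop_copair_inr : forall (D : C) (u : X ~> D) (v : Y ~> D),
    cop_copair u v ∘ cop_inr = v;
  cop_jointly_epic : forall (D : C) (c d : cop_ob ~> D),
    c ∘ cop_inl = d ∘ cop_inl -> c ∘ cop_inr = d ∘ cop_inr -> c = d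
}.

Record regular_factorization (X Y : C) (f : X ~> Y) := RegularFactorization {
  rf_ob : C;
  rf_epi : X ~> rf_ob;
  rf_mono : rf_ob ~> Y;
  rf_comp : rf_mono ∘ rf_epi = f;
  rf_epi_regular : is_regular_epi rf_epi;
  rf_mono_mono : is_mono rf_mono
}.

End Notions.

(* The terminal object sa_zero and the pullbacks provide all finite limits.
   Regularity is finite completeness together with (regular epi, mono)
   factorizations and pullback-stability of regular epis. Limits, coproducts and
   images are chosen, so that results hold for every choice of them. *)
Record semi_abelian_category := SemiAbelianCategory {
  sa_cat :> category;
  sa_zero : zero_object sa_cat;
  sa_pullback : forall (X Y Z : sa_cat) (f : X ~> Z) (g : Y ~> Z), pullback f g;
  sa_factorization : forall (X Y : sa_cat) (f : X ~> Y), regular_factorization f;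
  sa_regular : regular_epis_stable sa_cat;
  sa_exact : equivalence_relations_effective sa_cat;
  sa_protomodular : protomodular sa_cat;
  sa_coproduct : forall X Y : sa_cat, coproduct X Y
}.

Section SemiAbelian.
Variable C : semi_abelian_category.

Definition zero : C := zero_ob (sa_zero C).

Definition zerom (X Y : C) : X ~> Y :=
  from_zero (sa_zero C) Y ∘ to_zero (sa_zero C) X.

Definition is_zero (X : C) : Prop := is_iso (zerom X zero).

Definition pb (X Y Z : C) (f : X ~> Z) (g : Y ~> Z) : C :=
  pb_ob (sa_pullback f g).

Definition pb1 (X Y Z : C) (f : X ~> Z) (g : Y ~> Z) : pb f g ~> X :=
  pb_fst (sa_pullback f g).

Definition pb2 (X Y Z : C) (f : X ~> Z) (g : Y ~> Z) : pb f g ~> Y :=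
  pb_snd (sa_pullback f g).

Definition pbpair (X Y Z : C) (f : X ~> Z) (g : Y ~> Z) (T : C)
    (a : T ~> X) (b : T ~> Y) (e : f ∘ a = g ∘ b) : T ~> pb f g :=
  pb_pair (sa_pullback f g) e.

Definition cprod (X Y : C) : C := pb (zerom X zero) (zerom Y zero).

Definition cpair (T X Y : C) (a : T ~> X) (b : T ~> Y) : T ~> cprod X Y :=
  pbpair (to_zero_unique (zerom X zero ∘ a) (zerom Y zero ∘ b)).

Definition csum (X Y : C) : C := cop_ob (sa_coproduct X Y).

Definition cinl (X Y : C) : X ~> csum X Y := cop_inl (sa_coproduct X Y).

Definition cinr (X Y : C) : Y ~> csum X Y := cop_inr (sa_coproduct X Y).

Definition ccopair (X Y D : C) (u : X ~> D) (v : Y ~> D) : csum X Y ~> D :=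
  cop_copair (sa_coproduct X Y) u v.

Definition csum3 (X Y Z : C) : C := csum (csum X Y) Z.

Definition ccopair3 (X Y Z D : C) (u : X ~> D) (v : Y ~> D) (t : Z ~> D) :
    csum3 X Y Z ~> D :=
  ccopair (ccopair u v) t.

Definition ker (X Y : C) (f : X ~> Y) : C := pb f (zerom zero Y).

Definition kerm (X Y : C) (f : X ~> Y) : ker f ~> X := pb1 f (zerom zero Y).

Definition Im (X Y : C) (f : X ~> Y) : C := rf_ob (sa_factorization f).

Definition im (X Y : C) (f : X ~> Y) : Im f ~> Y :=
  rf_mono (sa_factorization f).

(* K + L -> K × L *)
Definition sum_to_prod (K L : C) : csum K L ~> cprod K L :=
  cpair (ccopair (idm K) (zerom L K)) (ccopair (zerom K L) (idm L)).

Definition cosmash (K L : C) : C := ker (sum_to_prod K L).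

(* K + L + M -> (K + L) × (K + M) × (L + M) *)
Definition sum3_to_prod (K L M : C) :
    csum3 K L M ~> cprod (cprod (csum K L) (csum K M)) (csum L M) :=
  cpair
    (cpair
      (ccopair3 (cinl K L) (cinr K L) (zerom M (csum K L)))
      (ccopair3 (cinl K M) (zerom L (csum K M)) (cinr K M)))
    (ccopair3 (zerom K (csum L M)) (cinl L M) (cinr L M)).

Definition cosmash3 (K L M : C) : C := ker (sum3_to_prod K L M).

Definition two_nilpotent : Prop := forall K L M : C, is_zero (cosmash3 K L M).

(* The composites whose images are the subobjects [K,L] and [K,L,M] of D. *)
Definition higgins_map (K L D : C) (k : K ~> D) (l : L ~> D) :
    cosmash K L ~> D :=
  ccopair k l ∘ kerm (sum_to_prod K L).

Definition higgins3_map (K L M D : C) (k : K ~> D) (l : L ~> D) (m : M ~> D) :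
    cosmash3 K L M ~> D :=
  ccopair3 k l m ∘ kerm (sum3_to_prod K L M).

Definition higgins (K L D : C) (k : K ~> D) (l : L ~> D) : C :=
  Im (higgins_map k l).

Definition higgins3 (K L M D : C) (k : K ~> D) (l : L ~> D) (m : M ~> D) : C :=
  Im (higgins3_map k l m).

Definition huq_commute (X Y D : C) (x : X ~> D) (y : Y ~> D) : Prop :=
  exists phi : cprod X Y ~> D,
    phi ∘ cpair (idm X) (zerom X Y) = x /\ phi ∘ cpair (zerom Y X) (idm Y) = y.

(* The retraction <1_W; 0> : W + X -> W of the coproduct inclusion. *)
Definition retr (W X : C) : csum W X ~> W := ccopair (idm W) (zerom X W).

Lemma retr_inl (W X : C) : retr W X ∘ cinl W X = idm W.
Proof. apply cop_copair_inl. Qed.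

Lemma e1_square (W X Y : C) :
  retr W X ∘ idm (csum W X) = retr W Y ∘ (cinl W Y ∘ retr W X).
Proof. now rewrite comp_idr, comp_assoc, retr_inl, comp_idl. Qed.

Lemma e2_square (W X Y : C) :
  retr W X ∘ (cinl W X ∘ retr W Y) = retr W Y ∘ idm (csum W Y).
Proof. now rewrite comp_idr, comp_assoc, retr_inl, comp_idl. Qed.

Definition e1 (W X Y : C) : csum W X ~> pb (retr W X) (retr W Y) :=
  pbpair (e1_square W X Y).

Definition e2 (W X Y : C) : csum W Y ~> pb (retr W X) (retr W Y) :=
  pbpair (e2_square W X Y).

Definition commute_over (X Y W D : C) (x : X ~> D) (y : Y ~> D) (w : W ~> D) :
    Prop :=
  exists phi : pb (retr W X) (retr W Y) ~> D,
    phi ∘ e1 W X Y = ccopair w x /\ phi ∘ e2 W X Y = ccopair w y.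

Definition huq_implies_commute_over : Prop :=
  forall (X Y W D : C) (x : X ~> D) (y : Y ~> D) (w : W ~> D),
    huq_commute x y -> commute_over x y w.

Definition commute_over_weight_independent : Prop :=
  forall (X Y D : C) (x : X ~> D) (y : Y ~> D)
    (W : C) (w : W ~> D) (W' : C) (w' : W' ~> D),
    commute_over x y w <-> commute_over x y w'.

Definition higgins_trivial_implies_higgins3_trivial : Prop :=
  forall (X Y W D : C) (x : X ~> D) (y : Y ~> D) (w : W ~> D),
    is_zero (higgins (im x) (im y)) -> is_zero (higgins3 (im x) (im y) (im w)).

(* The three conditions are equivalent in every semi-abelian category; all of
   them are required here, so that no one of them is preferred. *)
Definition condition_W : Prop :=
  huq_implies_commute_over /\
  commute_over_weight_independent /\
  higgins_trivial_implies_higgins3_trivial.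

End SemiAbelian.

(* Main.v *)
Require Import Defs.

(** Write [P] for the pullback [(W + X) ×_W (W + Y)] that carries the weighted
    commutation.  The idea is that [P] is a quotient of [W + X + Y], and that
    two-nilpotency makes the kernel of the quotient map as small as [X ◇ Y].

    The comparison [c : W + X + Y -> P] with components [e1] and [e2 ∘ cinr] is,
    up to an isomorphism, a regular epimorphism: by protomodularity the section
    [e1] of the projection [P -> W + X] and the kernel of that projection
    together generate [P], and [e2] covers the kernel.  In a protomodular
    category a regular epimorphism is the cokernel of its kernel, so [x] and
    [y] commute over [w] as soon as the map [W + X + Y -> D] induced by [w], [x]
    and [y] vanishes on [Ker c] ([weighted_comparison_factor]).

    An element of [Ker c] is one that dies both when [X] and when [Y] is sent
    to [0].  Sending [W] to [0] therefore defines a map [Ker c -> X ◇ Y], split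
    by the inclusion of [X + Y] into [W + X + Y], and its kernel lies in
    [W ◇ X ◇ Y].  In a two-nilpotent category this kernel is zero, and a split
    epimorphism with zero kernel is an isomorphism.  Hence every element of
    [Ker c] comes from [X ◇ Y] ([weighted_kernel_from_cosmash]), where the map
    induced by [x] and [y] vanishes whenever [x] and [y] Huq-commute.

    This gives the first form of condition (W).  Conversely, commuting over any
    weight restricts along [X × Y -> P] to Huq-commuting, so that in the
    two-nilpotent case commuting over [w] is equivalent to a property that does
    not mention [w]; this is the second form.  The third holds because
    [K,L,M] is the image of a map out of a zero object. *)

Set Implicit Arguments.
Unset Strict Implicit.
Unset Printing Implicit Defensive.
Local Open Scope cat_scope.

(** * Zero morphisms, products, coproducts and kernels *)

Section Calculus.
Variable C : semi_abelian_category.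

Lemma comp_zerom (X Y Z : C) (f : Y ~> Z) : f ∘ zerom X Y = zerom X Z.
Proof.
  unfold zerom. rewrite comp_assoc. f_equal. apply from_zero_unique.
Qed.

Lemma zerom_comp (X Y Z : C) (f : X ~> Y) : zerom Y Z ∘ f = zerom X Z.
Proof.
  unfold zerom. rewrite <- comp_assoc. f_equal. apply to_zero_unique.
Qed.

Lemma ccopair_inl (X Y D : C) (u : X ~> D) (v : Y ~> D) :
  ccopair u v ∘ cinl X Y = u.
Proof. apply cop_copair_inl. Qed.

Lemma ccopair_inr (X Y D : C) (u : X ~> D) (v : Y ~> D) :
  ccopair u v ∘ cinr X Y = v.
Proof. apply cop_copair_inr. Qed.

Lemma csum_ext (X Y D : C) (f g : csum X Y ~> D) :
  f ∘ cinl X Y = g ∘ cinl X Y -> f ∘ cinr X Y = g ∘ cinr X Y -> f = g.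
Proof. apply cop_jointly_epic. Qed.

Lemma comp_ccopair (X Y D E : C) (h : D ~> E) (u : X ~> D) (v : Y ~> D) :
  h ∘ ccopair u v = ccopair (h ∘ u) (h ∘ v).
Proof.
  apply csum_ext; rewrite <- comp_assoc.
  - now rewrite !ccopair_inl.
  - now rewrite !ccopair_inr.
Qed.

Lemma ccopair_id (X Y : C) : ccopair (cinl X Y) (cinr X Y) = idm (csum X Y).
Proof.
  apply csum_ext; rewrite comp_idl; [apply ccopair_inl | apply ccopair_inr].
Qed.

Lemma ccopair_zero (X Y D : C) :
  ccopair (zerom X D) (zerom Y D) = zerom (csum X Y) D.
Proof.
  apply csum_ext; rewrite zerom_comp; [apply ccopair_inl | apply ccopair_inr].
Qed.

Lemma pb_sq (X Y Z : C) (f : X ~> Z) (g : Y ~> Z) : f ∘ pb1 f g = g ∘ pb2 f g.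
Proof. apply pb_square. Qed.

Lemma pb1_pair (X Y Z T : C) (f : X ~> Z) (g : Y ~> Z) (a : T ~> X) (b : T ~> Y)
    (e : f ∘ a = g ∘ b) : pb1 f g ∘ pbpair e = a.
Proof. apply pb_fst_pair. Qed.

Lemma pb2_pair (X Y Z T : C) (f : X ~> Z) (g : Y ~> Z) (a : T ~> X) (b : T ~> Y)
    (e : f ∘ a = g ∘ b) : pb2 f g ∘ pbpair e = b.
Proof. apply pb_snd_pair. Qed.

Lemma pb_ext (X Y Z T : C) (f : X ~> Z) (g : Y ~> Z) (a b : T ~> pb f g) :
  pb1 f g ∘ a = pb1 f g ∘ b -> pb2 f g ∘ a = pb2 f g ∘ b -> a = b.
Proof. apply pb_jointly_monic. Qed.

Lemma pb_is_pullback (X Y Z : C) (f : X ~> Z) (g : Y ~> Z) :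
  is_pullback f g (pb1 f g) (pb2 f g).
Proof.
  split; [apply pb_sq |].
  intros T a b e. exists (pbpair e). split.
  - split; [apply pb1_pair | apply pb2_pair].
  - intros d [Ha Hb]. apply pb_ext.
    + now rewrite pb1_pair.
    + now rewrite pb2_pair.
Qed.

Definition pr1 (X Y : C) : cprod X Y ~> X := pb1 _ _.
Definition pr2 (X Y : C) : cprod X Y ~> Y := pb2 _ _.

Lemma pr1_pair (T X Y : C) (a : T ~> X) (b : T ~> Y) : pr1 X Y ∘ cpair a b = a.
Proof. apply pb1_pair. Qed.

Lemma pr2_pair (T X Y : C) (a : T ~> X) (b : T ~> Y) : pr2 X Y ∘ cpair a b = b.
Proof. apply pb2_pair. Qed.

Lemma cprod_ext (T X Y : C) (a b : T ~> cprod X Y) :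
  pr1 X Y ∘ a = pr1 X Y ∘ b -> pr2 X Y ∘ a = pr2 X Y ∘ b -> a = b.
Proof. apply pb_ext. Qed.

Lemma cpair_comp (S T X Y : C) (a : T ~> X) (b : T ~> Y) (t : S ~> T) :
  cpair a b ∘ t = cpair (a ∘ t) (b ∘ t).
Proof.
  apply cprod_ext; rewrite comp_assoc.
  - now rewrite !pr1_pair.
  - now rewrite !pr2_pair.
Qed.

Lemma cpair_zero (T X Y : C) :
  cpair (zerom T X) (zerom T Y) = zerom T (cprod X Y).
Proof.
  apply cprod_ext; rewrite comp_zerom; [apply pr1_pair | apply pr2_pair].
Qed.

Lemma comp_kerm (X Y : C) (f : X ~> Y) : f ∘ kerm f = zerom (ker f) Y.
Proof. exact (eq_trans (pb_sq _ _) (zerom_comp _ _)). Qed.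

Lemma ker_lift (X Y T : C) (f : X ~> Y) (a : T ~> X) :
  f ∘ a = zerom T Y -> exists a' : T ~> ker f, kerm f ∘ a' = a.
Proof.
  intros H.
  assert (e : f ∘ a = zerom (zero C) Y ∘ zerom T (zero C))
    by now rewrite comp_zerom.
  exists (pbpair e). apply pb1_pair.
Qed.

Lemma kerm_mono (X Y : C) (f : X ~> Y) : is_mono (kerm f).
Proof.
  intros T a b H. apply pb_ext; [exact H | apply to_zero_unique].
Qed.

Lemma is_zero_id (X : C) : is_zero X <-> idm X = zerom X X.
Proof.
  split.
  - intros [g [Hg _]]. rewrite <- Hg. apply comp_zerom.
  - intros H. exists (zerom (zero C) X). split.
    + rewrite H. apply comp_zerom.
    + apply to_zero_unique.
Qed.

Lemma from_is_zero (X Y : C) (f : X ~> Y) : is_zero X -> f = zerom X Y.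
Proof.
  intros H. rewrite <- (comp_idr f), (proj1 (is_zero_id X) H).
  apply comp_zerom.
Qed.

Lemma regular_epi_epi (X Y D : C) (q : X ~> Y) (a b : Y ~> D) :
  is_regular_epi q -> a ∘ q = b ∘ q -> a = b.
Proof.
  intros (R & u & v & Huv & Huniv) H.
  assert (Hbq : (b ∘ q) ∘ u = (b ∘ q) ∘ v)
    by now rewrite <- !comp_assoc, Huv.
  destruct (Huniv D (b ∘ q) Hbq) as [k [_ Hk]].
  transitivity k; [symmetry |]; apply Hk; [exact H | reflexivity].
Qed.

Lemma Im_from_zero (X Y : C) (f : X ~> Y) : is_zero X -> is_zero (Im f).
Proof.
  intros H. apply is_zero_id.
  apply (regular_epi_epi (rf_epi_regular (sa_factorization f))).
  now rewrite (from_is_zero (rf_epi _) H), !comp_zerom.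
Qed.

End Calculus.

(** * Consequences of protomodularity *)

Section Protomodular.
Variable C : semi_abelian_category.

(** The instance of protomodularity for the base change along [0 -> Y], which
    sends a point to the kernel of its retraction. *)
Lemma split_short_five (Y A B : C) (p : A ~> Y) (s : Y ~> A) (q : B ~> Y)
    (t : Y ~> B) (h : A ~> B) (h' : ker p ~> ker q) :
  p ∘ s = idm Y -> q ∘ t = idm Y -> q ∘ h = p -> h ∘ s = t ->
  kerm q ∘ h' = h ∘ kerm p -> is_iso h' -> is_iso h.
Proof.
  intros Hs Ht Hq Hh Hk.
  apply (@sa_protomodular C _ _ (zerom (zero C) Y) _ p s _ q t h
           _ (kerm p) (pb2 _ _) _ (kerm q) (pb2 _ _) h' Hs Ht Hq Hh
           (pb_is_pullback _ _) (pb_is_pullback _ _) Hk).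
  apply to_zero_unique.
Qed.

(** A section and the kernel of its retraction are jointly extremally epic:
    on kernels, a subobject that contains both restricts to a split mono. *)
Lemma section_kernel_extremal (Y A M : C) (p : A ~> Y) (s : Y ~> A)
    (m : M ~> A) (s' : Y ~> M) :
  p ∘ s = idm Y -> is_mono m -> m ∘ s' = s ->
  (forall (T : C) (a : T ~> A), p ∘ a = zerom T Y -> exists a', m ∘ a' = a) ->
  is_iso m.
Proof.
  intros Hs Hm Hs' Hker.
  destruct (Hker _ _ (comp_kerm p)) as [k Hk].
  destruct (@ker_lift C _ _ _ p (m ∘ kerm (p ∘ m))) as [h Hh].
  { rewrite comp_assoc. apply comp_kerm. }
  destruct (@ker_lift C _ _ _ (p ∘ m) k) as [h1 Hh1].
  { rewrite <- comp_assoc, Hk. apply comp_kerm. }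
  apply (@split_short_five _ _ _ (p ∘ m) s' p s m h); auto.
  - now rewrite <- comp_assoc, Hs'.
  - exists h1. split.
    + apply (@kerm_mono C _ _ (p ∘ m)), Hm.
      now rewrite comp_idr, (comp_assoc (kerm _)), Hh1, comp_assoc, Hk, Hh.
    + apply (@kerm_mono C _ _ p).
      now rewrite comp_idr, comp_assoc, Hh, <- comp_assoc, Hh1.
Qed.

(** The equalizer of [u] and [v], obtained as the intersection of their
    graphs, is a subobject to which [section_kernel_extremal] applies. *)
Lemma section_kernel_epic (Y A D : C) (p : A ~> Y) (s : Y ~> A) (u v : A ~> D) :
  p ∘ s = idm Y -> u ∘ s = v ∘ s ->
  (forall (T : C) (a : T ~> A), p ∘ a = zerom T Y -> u ∘ a = v ∘ a) ->
  u = v.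
Proof.
  intros Hs Huv Hker.
  set (gu := cpair (idm A) u). set (gv := cpair (idm A) v).
  assert (Hu1 : pr1 A D ∘ gu = idm A) by apply pr1_pair.
  assert (Hu2 : pr2 A D ∘ gu = u) by apply pr2_pair.
  assert (Hv1 : pr1 A D ∘ gv = idm A) by apply pr1_pair.
  assert (Hv2 : pr2 A D ∘ gv = v) by apply pr2_pair.
  set (m := pb1 gu gv).
  assert (Hsq : gu ∘ m = gv ∘ pb2 gu gv) by apply pb_sq.
  assert (H12 : m = pb2 gu gv).
  { now rewrite <- (comp_idl m), <- Hu1, <- comp_assoc, Hsq, comp_assoc, Hv1,
      comp_idl. }
  assert (Hm : u ∘ m = v ∘ m).
  { now rewrite <- Hu2, <- comp_assoc, Hsq, comp_assoc, Hv2, <- H12. }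
  assert (Hlift : forall (T : C) (a : T ~> A), u ∘ a = v ∘ a ->
                    exists a', m ∘ a' = a).
  { intros T a Ha.
    assert (e : gu ∘ a = gv ∘ a)
      by (unfold gu, gv; now rewrite !cpair_comp, Ha).
    exists (pbpair e). apply pb1_pair. }
  destruct (Hlift _ s Huv) as [s' Hs'].
  assert (Hiso : is_iso m).
  { apply (@section_kernel_extremal _ _ _ p s m s' Hs); auto.
    intros T a b H. apply pb_ext; [exact H |]. now rewrite <- H12. }
  destruct Hiso as [n [_ Hn]].
  now rewrite <- (comp_idr u), <- (comp_idr v), <- Hn, !comp_assoc, Hm.
Qed.

(** Regular epimorphisms are cokernels of their kernels: the kernel pair of
    [q] is generated by its diagonal and the kernel of its first projection,
    and [f] coequalizes the two projections on both. *)
Lemma regular_epi_cokernel (A B D : C) (q : A ~> B) (f : A ~> D) :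
  is_regular_epi q ->
  (forall (T : C) (a : T ~> A), q ∘ a = zerom T B -> f ∘ a = zerom T D) ->
  exists k : B ~> D, k ∘ q = f.
Proof.
  intros (R & u & v & Huv & Huniv) Hker.
  assert (Hpair : f ∘ pb1 q q = f ∘ pb2 q q).
  { assert (e : q ∘ idm A = q ∘ idm A) by reflexivity.
    apply (@section_kernel_epic _ _ _ (pb1 q q) (pbpair e)).
    - apply pb1_pair.
    - now rewrite <- !comp_assoc, pb1_pair, pb2_pair.
    - intros T a Ha. rewrite <- !comp_assoc, Ha, comp_zerom.
      symmetry. apply Hker.
      now rewrite comp_assoc, <- pb_sq, <- comp_assoc, Ha, comp_zerom. }
  assert (Hf : f ∘ u = f ∘ v).
  { rewrite <- (pb1_pair Huv), comp_assoc, Hpair, <- comp_assoc.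
    now rewrite pb2_pair. }
  destruct (Huniv D f Hf) as [k [Hk _]]. now exists k.
Qed.

(** A split epimorphism with zero kernel is an isomorphism, with its section
    as inverse: the section is a morphism of points from the trivial point,
    and it induces a morphism between zero kernels. *)
Lemma split_epi_zero_kernel (Y A : C) (p : A ~> Y) (s : Y ~> A) :
  p ∘ s = idm Y ->
  (forall (T : C) (a : T ~> A), p ∘ a = zerom T Y -> a = zerom T A) ->
  s ∘ p = idm A.
Proof.
  intros Hs Hker.
  assert (Hp : idm (ker p) = zerom _ _).
  { apply (@kerm_mono C _ _ p). rewrite comp_idr, comp_zerom.
    apply Hker, comp_kerm. }
  assert (Hi : idm (ker (idm Y)) = zerom _ _).
  { apply (@kerm_mono C _ _ (idm Y)). rewrite comp_idr, comp_zerom.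
    rewrite <- (comp_idl (kerm (idm Y))). apply comp_kerm. }
  assert (Hiso : is_iso s).
  { apply (@split_short_five _ _ _ (idm Y) (idm Y) p s s (zerom _ _));
      rewrite ?comp_idl, ?comp_idr; auto.
    - rewrite comp_zerom, <- (comp_idl (kerm (idm Y))), comp_kerm.
      symmetry. apply comp_zerom.
    - exists (zerom _ _). rewrite !comp_zerom. now rewrite Hp, Hi. }
  destruct Hiso as [n [_ Hn]].
  (* [n] is an inverse of [s], hence equal to [p] *)
  now rewrite <- (comp_idr (s ∘ p)), <- Hn, comp_assoc, <- (comp_assoc s),
    Hs, comp_idr.
Qed.

End Protomodular.

(** * The pullback of a weighted cospan as a quotient of a ternary sum *)

Section Weighted.
Variable C : semi_abelian_category.

Lemma pb1_e1 (W X Y : C) : pb1 _ _ ∘ e1 W X Y = idm (csum W X).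
Proof. apply pb1_pair. Qed.

Lemma pb2_e1 (W X Y : C) : pb2 _ _ ∘ e1 W X Y = cinl W Y ∘ retr W X.
Proof. apply pb2_pair. Qed.

Lemma pb1_e2 (W X Y : C) : pb1 _ _ ∘ e2 W X Y = cinl W X ∘ retr W Y.
Proof. apply pb1_pair. Qed.

Lemma pb2_e2 (W X Y : C) : pb2 _ _ ∘ e2 W X Y = idm (csum W Y).
Proof. apply pb2_pair. Qed.

Lemma retr_inr (W X : C) : retr W X ∘ cinr W X = zerom X W.
Proof. apply ccopair_inr. Qed.

Lemma comp_retr (W X D : C) (h : W ~> D) :
  h ∘ retr W X = ccopair h (zerom X D).
Proof. unfold retr. now rewrite comp_ccopair, comp_idr, comp_zerom. Qed.

Lemma e2_inl (W X Y : C) : e2 W X Y ∘ cinl W Y = e1 W X Y ∘ cinl W X.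
Proof.
  apply pb_ext; rewrite !comp_assoc.
  - now rewrite pb1_e1, pb1_e2, comp_idl, <- comp_assoc, retr_inl, comp_idr.
  - now rewrite pb2_e1, pb2_e2, comp_idl, <- comp_assoc, retr_inl, comp_idr.
Qed.

Definition weighted_comparison (W X Y : C) :
    csum3 W X Y ~> pb (retr W X) (retr W Y) :=
  ccopair (e1 W X Y) (e2 W X Y ∘ cinr W Y).

Lemma pb1_weighted_comparison (W X Y : C) :
  pb1 _ _ ∘ weighted_comparison W X Y =
  ccopair3 (cinl W X) (cinr W X) (zerom Y _).
Proof.
  unfold weighted_comparison, ccopair3, csum3.
  rewrite comp_ccopair, pb1_e1, comp_assoc, pb1_e2, <- comp_assoc, retr_inr.
  now rewrite comp_zerom, ccopair_id.
Qed.

Lemma pb2_weighted_comparison (W X Y : C) :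
  pb2 _ _ ∘ weighted_comparison W X Y =
  ccopair3 (cinl W Y) (zerom X _) (cinr W Y).
Proof.
  unfold weighted_comparison, ccopair3, csum3.
  rewrite comp_ccopair, pb2_e1, comp_assoc, pb2_e2, comp_idl.
  now rewrite comp_retr.
Qed.

Lemma weighted_comparison_e2 (W X Y : C) :
  weighted_comparison W X Y ∘ ccopair (cinl _ Y ∘ cinl W X) (cinr _ Y) =
  e2 W X Y.
Proof.
  unfold weighted_comparison, csum3.
  rewrite comp_ccopair, comp_assoc, ccopair_inl, ccopair_inr, <- e2_inl.
  now rewrite <- comp_ccopair, ccopair_id, comp_idr.
Qed.

(** The mono part [m] of the image factorization of the comparison contains
    [e1], and it contains [e2] because the comparison is defined on all three
    summands.  An element [a] of the kernel of the first projection has the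
    form [e2 ∘ b], where [b] is its second component; hence [m] is an
    isomorphism and the comparison is a cokernel of its kernel. *)
Lemma weighted_comparison_factor (W X Y D : C) (f : csum3 W X Y ~> D) :
  (forall (T : C) (a : T ~> csum3 W X Y),
     weighted_comparison W X Y ∘ a = zerom T _ -> f ∘ a = zerom T D) ->
  exists phi, phi ∘ weighted_comparison W X Y = f.
Proof.
  intros Hf.
  destruct (sa_factorization (weighted_comparison W X Y))
    as [I q m Hmq Hq Hm].
  assert (Hiso : is_iso m).
  { apply (@section_kernel_extremal C _ _ _ (pb1 _ _) (e1 W X Y) m
             (q ∘ cinl _ _)).
    - apply pb1_e1.
    - exact Hm.
    - rewrite comp_assoc, Hmq. apply ccopair_inl.
    - intros T a Ha.
      assert (Hr : retr W Y ∘ (pb2 _ _ ∘ a) = zerom T W)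
        by now rewrite comp_assoc, <- pb_sq, <- comp_assoc, Ha, comp_zerom.
      set (i := ccopair (cinl _ Y ∘ cinl W X) (cinr _ Y)
                : csum W Y ~> csum3 W X Y).
      assert (Hi : weighted_comparison W X Y ∘ i = e2 W X Y)
        by apply weighted_comparison_e2.
      exists (q ∘ (i ∘ (pb2 _ _ ∘ a))).
      rewrite comp_assoc, Hmq, comp_assoc, Hi.
      apply pb_ext.
      + now rewrite comp_assoc, pb1_e2, <- comp_assoc, Hr, Ha, comp_zerom.
      + now rewrite comp_assoc, pb2_e2, comp_idl. }
  destruct Hiso as [n [Hn _]].
  destruct (@regular_epi_cokernel C _ _ _ q f Hq) as [k Hk].
  { intros T a Ha. apply Hf. now rewrite <- Hmq, <- comp_assoc, Ha, comp_zerom. }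
  exists (k ∘ n).
  now rewrite <- Hmq, <- comp_assoc, (comp_assoc n), Hn, comp_idl.
Qed.

(** The three components of the map whose kernel is [W ◇ X ◇ Y] are the two
    components of the comparison and the map sending [W] to [0]. *)
Lemma weighted_kernel_cosmash3 (W X Y T : C) (a : T ~> csum3 W X Y) :
  weighted_comparison W X Y ∘ a = zerom T _ ->
  ccopair3 (zerom W _) (cinl X Y) (cinr X Y) ∘ a = zerom T _ ->
  exists a' : T ~> cosmash3 W X Y, kerm (sum3_to_prod W X Y) ∘ a' = a.
Proof.
  intros Hc Hp. apply ker_lift. unfold sum3_to_prod.
  rewrite !cpair_comp, Hp.
  rewrite <- pb1_weighted_comparison, <- pb2_weighted_comparison.
  now rewrite <- !comp_assoc, Hc, !comp_zerom, !cpair_zero.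
Qed.

(** Sending [W] to [0] maps [Ker c] to [X ◇ Y] with a section induced by the
    inclusion of [X + Y]; its kernel embeds in [W ◇ X ◇ Y], so when the latter
    is zero the two maps are mutually inverse. *)
Lemma weighted_kernel_from_cosmash (W X Y T : C) (a : T ~> csum3 W X Y) :
  is_zero (cosmash3 W X Y) ->
  weighted_comparison W X Y ∘ a = zerom T _ ->
  exists b : T ~> cosmash X Y,
    ccopair (cinl _ _ ∘ cinr W X) (cinr _ Y) ∘ kerm (sum_to_prod X Y) ∘ b = a.
Proof.
  intros Hz Ha.
  set (c := weighted_comparison W X Y) in *.
  set (pi := ccopair3 (zerom W _) (cinl X Y) (cinr X Y)).
  set (iota := ccopair (cinl _ _ ∘ cinr W X) (cinr _ Y)
               : csum X Y ~> csum3 W X Y).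
  assert (Hpi : pi ∘ iota = idm _).
  { unfold iota, pi, ccopair3, csum3.
    now rewrite comp_ccopair, comp_assoc, ccopair_inl, !ccopair_inr, ccopair_id. }
  destruct (@ker_lift C _ _ _ (sum_to_prod X Y) (pi ∘ kerm c)) as [p Hp].
  { assert (H1 : ccopair (idm X) (zerom Y X) ∘ pi =
                 ccopair (zerom W X) (idm X) ∘ (pb1 _ _ ∘ c)).
    { unfold c. rewrite pb1_weighted_comparison. unfold pi, ccopair3, csum3.
      now rewrite !comp_ccopair, !ccopair_inl, !ccopair_inr, !comp_zerom. }
    assert (H2 : ccopair (zerom X Y) (idm Y) ∘ pi =
                 ccopair (zerom W Y) (idm Y) ∘ (pb2 _ _ ∘ c)).
    { unfold c. rewrite pb2_weighted_comparison. unfold pi, ccopair3, csum3.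
      now rewrite !comp_ccopair, !ccopair_inl, !ccopair_inr, !comp_zerom. }
    unfold sum_to_prod. rewrite comp_assoc, !cpair_comp, H1, H2.
    now rewrite <- !comp_assoc, comp_kerm, !comp_zerom, cpair_zero. }
  destruct (@ker_lift C _ _ _ c (iota ∘ kerm (sum_to_prod X Y))) as [s Hs].
  { assert (Hk := comp_kerm (sum_to_prod X Y)).
    apply pb_ext; rewrite !comp_assoc; unfold c.
    - assert (H1 : pb1 _ _ ∘ weighted_comparison W X Y ∘ iota =
                   cinr W X ∘ (pr1 _ _ ∘ sum_to_prod X Y)).
      { rewrite pb1_weighted_comparison.
        unfold sum_to_prod, iota, ccopair3, csum3. rewrite pr1_pair.
        rewrite !comp_ccopair, comp_assoc, ccopair_inl, !ccopair_inr.
        now rewrite comp_zerom, comp_idr. }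
      now rewrite H1, <- !comp_assoc, Hk, !comp_zerom.
    - assert (H2 : pb2 _ _ ∘ weighted_comparison W X Y ∘ iota =
                   cinr W Y ∘ (pr2 _ _ ∘ sum_to_prod X Y)).
      { rewrite pb2_weighted_comparison.
        unfold sum_to_prod, iota, ccopair3, csum3. rewrite pr2_pair.
        rewrite !comp_ccopair, comp_assoc, ccopair_inl, !ccopair_inr.
        now rewrite comp_zerom, comp_idr. }
      now rewrite H2, <- !comp_assoc, Hk, !comp_zerom. }
  assert (Hsp : s ∘ p = idm _).
  { apply split_epi_zero_kernel.
    - apply (@kerm_mono C _ _ (sum_to_prod X Y)).
      now rewrite comp_assoc, Hp, <- comp_assoc, Hs, comp_assoc, Hpi,
        comp_idl, comp_idr.
    - intros S d Hd.
      destruct (@weighted_kernel_cosmash3 W X Y S (kerm c ∘ d)) as [d' Hd'].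
      + now rewrite comp_assoc, comp_kerm, zerom_comp.
      + change (pi ∘ (kerm c ∘ d) = zerom S _).
        now rewrite comp_assoc, <- Hp, <- comp_assoc, Hd, comp_zerom.
      + apply (@kerm_mono C _ _ c).
        rewrite comp_zerom, <- Hd', (from_is_zero (kerm _) Hz).
        apply zerom_comp. }
  destruct (ker_lift Ha) as [a' Ha'].
  exists (p ∘ a').
  change (iota ∘ kerm (sum_to_prod X Y) ∘ (p ∘ a') = a).
  now rewrite <- Hs, <- comp_assoc, (comp_assoc s), Hsp, comp_idl.
Qed.

(** * Weighted commutation and Huq commutation *)

Lemma huq_commute_sum_to_prod (X Y D : C) (x : X ~> D) (y : Y ~> D) :
  huq_commute x y -> exists phi, phi ∘ sum_to_prod X Y = ccopair x y.
Proof.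
  intros (phi & Hx & Hy). exists phi. unfold sum_to_prod.
  apply csum_ext; rewrite <- comp_assoc, cpair_comp.
  - now rewrite !ccopair_inl.
  - now rewrite !ccopair_inr.
Qed.

Lemma huq_commute_over (X Y W D : C) (x : X ~> D) (y : Y ~> D) (w : W ~> D) :
  is_zero (cosmash3 W X Y) -> huq_commute x y -> commute_over x y w.
Proof.
  intros Hz Hxy.
  destruct (huq_commute_sum_to_prod Hxy) as [psi Hpsi].
  destruct (@weighted_comparison_factor W X Y D (ccopair3 w x y)) as [phi Hphi].
  { intros T a Ha. destruct (weighted_kernel_from_cosmash Hz Ha) as [b Hb].
    unfold ccopair3, csum3 in *.
    rewrite <- Hb, !comp_assoc, comp_ccopair, comp_assoc.
    rewrite ccopair_inl, !ccopair_inr, <- Hpsi, <- (comp_assoc psi), comp_kerm.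
    now rewrite comp_zerom, zerom_comp. }
  change (phi ∘ ccopair (e1 W X Y) (e2 W X Y ∘ cinr W Y) =
          ccopair (ccopair w x) y) in Hphi.
  rewrite comp_ccopair in Hphi.
  assert (H1 : phi ∘ e1 W X Y = ccopair w x).
  { apply (f_equal (fun h => h ∘ cinl _ _)) in Hphi.
    now rewrite !ccopair_inl in Hphi. }
  assert (H2 : phi ∘ (e2 W X Y ∘ cinr W Y) = y).
  { apply (f_equal (fun h => h ∘ cinr _ _)) in Hphi.
    now rewrite !ccopair_inr in Hphi. }
  exists phi. split; [exact H1 |].
  apply csum_ext; rewrite <- comp_assoc.
  - now rewrite e2_inl, comp_assoc, H1, !ccopair_inl.
  - now rewrite H2, ccopair_inr.
Qed.

(** The inclusions of [X] in [W + X] and of [Y] in [W + Y] both become zero in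
    [W], so they induce a map from [X × Y] to [(W + X) ×_W (W + Y)], along
    which a witness of weighted commutation restricts. *)
Lemma commute_over_huq (X Y W D : C) (x : X ~> D) (y : Y ~> D) (w : W ~> D) :
  commute_over x y w -> huq_commute x y.
Proof.
  intros (phi & Hx & Hy).
  assert (e : retr W X ∘ (cinr W X ∘ pr1 X Y) = retr W Y ∘ (cinr W Y ∘ pr2 X Y))
    by now rewrite !comp_assoc, !retr_inr, !zerom_comp.
  exists (phi ∘ pbpair e). split; rewrite <- comp_assoc.
  - transitivity (phi ∘ (e1 W X Y ∘ cinr W X));
      [f_equal | now rewrite comp_assoc, Hx, ccopair_inr].
    apply pb_ext; rewrite !comp_assoc.
    + now rewrite pb1_pair, pb1_e1, <- comp_assoc, pr1_pair, comp_idl, comp_idr.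
    + rewrite pb2_pair, pb2_e1, <- !comp_assoc, pr2_pair, retr_inr.
      now rewrite !comp_zerom.
  - transitivity (phi ∘ (e2 W X Y ∘ cinr W Y));
      [f_equal | now rewrite comp_assoc, Hy, ccopair_inr].
    apply pb_ext; rewrite !comp_assoc.
    + rewrite pb1_pair, pb1_e2, <- !comp_assoc, pr1_pair, retr_inr.
      now rewrite !comp_zerom.
    + now rewrite pb2_pair, pb2_e2, <- comp_assoc, pr2_pair, comp_idl, comp_idr.
Qed.

End Weighted.

Theorem mainTheorem5 (X : semi_abelian_category) :
  two_nilpotent X -> condition_W X.
Proof.
  intros H2. repeat split.
  - intros A B W D x y w. apply huq_commute_over, H2.
  - intros Hw. apply huq_commute_over; [apply H2 |].
    exact (commute_over_huq Hw).
  - intros Hw. apply huq_commute_over; [apply H2 |].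
    exact (commute_over_huq Hw).
  - intros A B W D x y w _. apply Im_from_zero, H2.
Qed.
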